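(* Let $G=(V,E)$ be a locally finite, connected, weighted graph with edge weight $\omega$ satisfying $\omega_{\min}>0$ and with vertex measure $\mu$, and suppose that $D_\mu<\infty$ and $D_\omega<\infty$ and that $G$ satisfies the curvature dimension condition $CDE'(n,0)$. Let $a:V\to\mathbb{R}$ be bounded, non-negative and not identically zero. Let $m>0$ and suppose that there exist $c>0$, $r_0>0$ and $x_0\in V$ with $a(x_0)>0$ such that $$c^{-1}r^m\le \mathcal{V}(x_0,r)\le c\,r^m\qquad\text{for all } r\ge r_0 .$$ If $\alpha=\frac{2}{m}$, then every non-negative solution $u$ of $$\partial_t u=\Delta u+u^{1+\alpha}\ \text{ in } (0,+\infty)\times V,\qquad u(0,x)=a(x)\ \text{ for } x\in V,$$ blows up in a finite time.
   Context: Graphs. $G=(V,E)$ is a locally finite, connected graph without loops or multiple edges; $y\sim x$ means that $x,y$ are joined by an edge. The edge weight $\omega:V\times V\to[0,\infty)$ satisfies $\omega_{xy}=\omega_{yx}$, and $\omega_{xy}>0$ iff $x\sim y$; $\omega_{\min}:=\inf_{(x,y)\in E}\omega_{xy}>0$. The measure is a function $\mu:V\to(0,\infty)$, $\mu_{\max}:=\sup_{x\in V}\mu(x)$, $m(x):=\sum_{y\sim x}\omega_{xy}$, and $$D_\omega:=\frac{\mu_{\max}}{\omega_{\min}},\qquad D_\mu:=\sup_{x\in V}\frac{m(x)}{\mu(x)}.$$ $d(x,y)$ is the number of edges in a shortest path joining $x$ and $y$; $B_r=B_r(x_0)$ is the set of vertices at distance at most $r$ from $x_0$; $\mathcal{V}(x_0,r)=\sum_{y\in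 B_r(x_0)}\mu(y)$. Laplacian. For $f:V\to\mathbb{R}$, $\Delta f(x)=\frac{1}{\mu(x)}\sum_{y\sim x}\omega_{xy}(f(y)-f(x))$. Curvature. Put $2\Gamma(f,g)=\Delta(fg)-f\Delta g-g\Delta f$, $2\Gamma_2(f,g)=\Delta\Gamma(f,g)-\Gamma(f,\Delta g)-\Gamma(\Delta f,g)$, $\Gamma(f)=\Gamma(f,f)$, $\Gamma_2(f)=\Gamma_2(f,f)$. $G$ satisfies $CDE'(n,K)$ if for every positive function $f:V\to(0,\infty)$ and every $x\in V$, $$\Gamma_2(f)(x)-\Gamma\Big(f,\frac{\Gamma(f)}{f}\Big)(x)\ge \frac1n f(x)^2(\Delta\log f)(x)^2+K\,\Gamma(f)(x).$$ Solutions and blow-up. For $T>0$, a non-negative function $u=u(t,x)$ is a non-negative solution of the problem in $[0,T]$ if $u$ is continuous with respect to $t$ and satisfies the problem (equation and initial condition) in $[0,T]\times V$. For a solution $u$, let $T_\infty$ be the supremum of all $T$ such that for any $T'<T$ the solution $u$ is bounded in $[0,T']\times V$. The solution blows up in a finite time if $T_\infty<\infty$; it is global if $T_\infty=\infty$. *)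

(* Defs.v *)
From HB Require Import structures.
From mathcomp Require Import all_boot all_order all_algebra.
From mathcomp Require Import all_classical all_reals all_analysis.

Set Implicit Arguments.
Unset Strict Implicit.
Unset Printing Implicit Defensive.

Import Order.TTheory GRing.Theory Num.Theory.
Import numFieldNormedType.Exports.

Local Open Scope classical_set_scope.
Local Open Scope ring_scope.

Record weighted_graph (R : realType) (V : choiceType) := WeightedGraph {
  adj : rel V;
  weight : V -> V -> R;
  mu : V -> R;
  adj_irrefl : irreflexive adj;
  adj_sym : symmetric adj;
  adj_locally_finite : forall x, finite_set [set y | adj x y];
  adj_connected : forall x y, exists2 p : seq V, path adj x p & last x p = y;
  weight_ge0 : forall x y, 0 <= weight x y;
  weight_sym : forall x y, weight x y = weight y x;
  weight_gt0 : forall x y, (0 < weight x y) = adj x y;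
  mu_gt0 : forall x, 0 < mu x
}.

Section Graph.
Variables (R : realType) (V : choiceType) (G : weighted_graph R V).
Implicit Types (x y : V) (f g : V -> R).

Definition neighbours x : set V := [set y | adj G x y].

(* Sums over infinite sets are 0 by convention in fsbigop; all the sums below
   range over sets that are finite because G is locally finite. *)
Definition mdeg x : R := \sum_(y \in neighbours x) weight G x y.

Definition omega_min : \bar R :=
  ereal_inf [set (weight G e.1 e.2)%:E | e in [set e : V * V | adj G e.1 e.2]].

Definition mu_max : \bar R := ereal_sup [set (mu G x)%:E | x in [set: V]].

Definition D_omega : \bar R := (mu_max / omega_min)%E.

Definition D_mu : \bar R := ereal_sup [set (mdeg x / mu G x)%:E | x in [set: V]].

Definition joined_in x y : pred nat := fun k =>
  `[< exists p : seq V, [/\ path (adj G) x p, last x p = y & size p = k] >].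

Lemma joined_in_ex x y : exists k, joined_in x y k.
Proof.
have [p xp py] := adj_connected G x y.
by exists (size p); apply/asboolP; exists p.
Qed.

Definition gdist x y : nat := ex_minn (joined_in_ex x y).

Definition gball x (r : R) : set V := [set y | (gdist x y)%:R <= r].

Definition volume x (r : R) : R := \sum_(y \in gball x r) mu G y.

Definition laplacian f x : R :=
  (mu G x)^-1 * \sum_(y \in neighbours x) weight G x y * (f y - f x).

Definition Gamma f g x : R :=
  2^-1 * (laplacian (fun y => f y * g y) x
          - f x * laplacian g x - g x * laplacian f x).

Definition Gamma2 f g x : R :=
  2^-1 * (laplacian (Gamma f g) x
          - Gamma f (laplacian g) x - Gamma (laplacian f) g x).

Definition CDE' (n K : R) : Prop :=
  forall f, (forall y, 0 < f y) -> forall x,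
    Gamma2 f f x - Gamma f (fun y => Gamma f f y / f y) x >=
      n^-1 * f x ^+ 2 * laplacian (fun y => ln (f y)) x ^+ 2
      + K * Gamma f f x.

(* The equation is imposed on the open interval only: as u is continuous on
   [0, T] and the right-hand side is a finite sum, the one-sided equations at
   the endpoints follow. *)
Definition nonneg_solution (alpha : R) (a : V -> R) (T : R) (u : R -> V -> R) :=
  [/\ forall (t : R) x, t \in `[0, T] -> 0 <= u t x,
      forall x, {within `[0, T], continuous (fun t => u t x)},
      forall (t : R) x, t \in `]0, T[ ->
        is_derive t 1 (fun s => u s x)
          (laplacian (u t) x + u t x `^ (1 + alpha))
    & forall x, u 0 x = a x].

(* A solution comes with the interval [0, tau) on which it lives, where
   tau = +oo is allowed; the values of u outside [0, tau) are irrelevant. *)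
Definition nonneg_solution_upto (alpha : R) (a : V -> R) (tau : \bar R)
    (u : R -> V -> R) :=
  (0 < tau)%E /\
  forall T : R, 0 < T -> (T%:E < tau)%E -> nonneg_solution alpha a T u.

Definition bounded_upto (u : R -> V -> R) (T : R) : Prop :=
  exists M : R, forall (t : R) x, t \in `[0, T] -> `|u t x| <= M.

Definition T_infty (tau : \bar R) (u : R -> V -> R) : \bar R :=
  ereal_sup [set T%:E | T in [set T : R |
    (T%:E <= tau)%E /\ forall T', T' < T -> bounded_upto u T']].

Definition blows_up (tau : \bar R) (u : R -> V -> R) : Prop :=
  (T_infty tau u < +oo)%E.

End Graph.

(* Main.v *)
Require Import Defs.

(* Test-function argument. Suppose [u] is global, fix [L], and let
   [r(t, x) = 1 + t + d(x0, x)^2], [phi = max(0, 1 - ln r / L)] and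
   [v = u + delta]. The quantity [sum_x mu(x) v^(1 - 1/L) phi^(2 j + 2)] is at
   least a positive constant at [t = 0] and vanishes at [t = expR L]. Along
   the equation, the Laplacian term costs at most a constant times
   [v^(1 - 1/L) phi^(2 j) / (L r)]: the power [v^(- 1/L)] produces a dissipation
   that absorbs the first-order part of the discrete gradient of [phi], at the
   price of a factor [L], while [|grad phi|^2 <= 8 / (L^2 r)]. The reaction term
   absorbs this cost up to [(L r)^(- (1 + m/2))]. Integrating in time leaves
   [L^(-1 - m/2) sum_x mu(x) (1 + d(x0, x)^2)^(- m/2)]; by the upper volume bound
   each dyadic annulus contributes O(1) and there are O(L) of them, so the bound
   is O(L^(- m/2)), a contradiction as [L] grows. *)
From HB Require Import structures.
From mathcomp Require Import all_boot all_order all_algebra.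
From mathcomp Require Import finmap.
From mathcomp Require Import all_classical all_reals all_analysis.
From mathcomp Require Import ring lra.

Set Implicit Arguments.
Unset Strict Implicit.
Unset Printing Implicit Defensive.

Import Order.TTheory GRing.Theory Num.Theory.
Import numFieldNormedType.Exports.

Local Open Scope classical_set_scope.
Local Open Scope ring_scope.

(** * Real inequalities, the logarithmic cutoff, and absorption by the reaction term *)

Section Auxiliary.
Context {R : realType}.
Implicit Types (a b e A B L r t d v : R).

(** Convexity of [z^(- e)]: its graph lies above the tangent at [b]. The ratio of the two powers is
    an exponential, and both [expR s >= 1 + s] and [ln s <= s - 1] are tangent bounds. *)
Lemma powRN_tangent a b e : 0 < a -> 0 < b -> 0 <= e ->
  b `^ (- e) * (1 + e * (b - a) / b) <= a `^ (- e).
Proof.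
move=> a0 b0 e0; rewrite /powR !gt_eqF//.
have -> : - e * ln a = - e * ln b + e * (ln b - ln a) by ring.
rewrite expRD ler_pM2l ?expR_gt0//; apply: le_trans (expR_ge1Dx _).
rewrite lerD2l -mulrA ler_wpM2l//.
have -> : (b - a) / b = - (a / b - 1) by field; rewrite gt_eqF.
have : ln (a / b) <= a / b - 1.
  by rewrite -[in leLHS](subrKC 1 (a / b)) le_ln1Dx// ltrBrDl subrr divr_gt0.
rewrite ln_div ?posrE//; lra.
Qed.

(* The chain rule for the discrete gradient of [v^(- e)] fails, but completing
   the square with the convexity of [v^(- e)] replaces it. *)
Lemma edge_energy_le a b A B e : 0 < a -> 0 < b -> 0 <= A -> A <= B ->
  0 < e ->
  - ((1 + e^-1) * (b * b `^ (- e) * (B - A) ^+ 2)) <=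
  (b - a) * (a `^ (- e) * A ^+ 2 - b `^ (- e) * B ^+ 2).
Proof.
move=> a0 b0 A0 AB e0.
have B0 : 0 <= B by exact: le_trans AB.
have Q0 : 0 < b `^ (- e) by exact: powR_gt0.
have P0 : 0 < a `^ (- e) by exact: powR_gt0.
have := powRN_tangent a0 b0 (ltW e0).
set P := a `^ (- e) in P0 *; set Q := b `^ (- e) in Q0 *.
have LHS0 : - ((1 + e^-1) * (b * Q * (B - A) ^+ 2)) <= 0.
  by rewrite oppr_le0 mulr_ge0 ?addr_ge0 ?invr_ge0 ?mulr_ge0 ?sqr_ge0
     ?(ltW b0) ?(ltW Q0) ?(ltW e0) ?subr_ge0.
(* For [b <= a] both factors on the right are nonpositive, so only [a < b] needs convexity. *)
have [ba _|ab PQ] := leP b a.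
  apply: le_trans LHS0 _; rewrite mulr_le0// ?subr_le0//.
  rewrite ler_pM ?sqr_ge0 ?lerXn2r ?nnegrE ?(ltW P0)//.
  by rewrite /P /Q !powRN lef_pV2 ?posrE ?powR_gt0// ge0_ler_powR
     ?nnegrE ?(ltW e0) ?(ltW a0) ?(ltW b0).
have h0 : 0 < b - a by rewrite subr_gt0.
have -> : (b - a) * (P * A ^+ 2 - Q * B ^+ 2) =
  (b - a) * (P - Q * (1 + e * (b - a) / b)) * A ^+ 2
  + (b - a) * (Q * (1 + e * (b - a) / b) * A ^+ 2 - Q * B ^+ 2) by ring.
rewrite -[leLHS]add0r lerD//.
  by rewrite !mulr_ge0 ?sqr_ge0 ?subr_ge0// ltW.
rewrite -subr_ge0.
set D := B - A; have -> : B = A + D by rewrite /D; ring.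
(* Completing the square in [D] leaves exactly two nonnegative terms; the cross term is paid by
   [e^-1], which explains the factor [1 + e^-1]. *)
have -> : (b - a) * (Q * (1 + e * (b - a) / b) * A ^+ 2 - Q * (A + D) ^+ 2) -
   - ((1 + e^-1) * (b * Q * D ^+ 2)) =
   Q * (a * D ^+ 2 + (e * b)^-1 * (e * (b - a) * A - b * D) ^+ 2).
  by field; rewrite !gt_eqF.
apply: mulr_ge0 (ltW Q0) (addr_ge0 (mulr_ge0 (ltW a0) (sqr_ge0 _)) _).
by rewrite mulr_ge0 ?sqr_ge0// invr_ge0 mulr_ge0 ?(ltW e0) ?(ltW b0).
Qed.

(** Factor out [x - y]: each of the [i + 1] remaining monomials is at most [x^i]. This bounds the
    discrete gradient of a power of the cutoff by its value at the endpoint where it is larger. *)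
Lemma exprS_sub_le (x y : R) (i : nat) : 0 <= y -> y <= x ->
  (x ^+ i.+1 - y ^+ i.+1) ^+ 2 <= i.+1%:R ^+ 2 * (x ^+ i.*2 * (x - y) ^+ 2).
Proof.
move=> y0 yx; have x0 : 0 <= x by exact: le_trans yx.
have -> : x ^+ i.*2 = (x ^+ i) ^+ 2 by rewrite -exprM muln2.
rewrite -!exprMn ler_sqr ?nnegrE; last 2 first.
- by rewrite subr_ge0 lerXn2r.
- by rewrite !mulr_ge0 ?exprn_ge0 ?subr_ge0.
rewrite subrXX mulrC mulrA ler_wpM2r ?subr_ge0//.
rewrite mulr_natl -[X in _ *+ X]card_ord -sumr_const ler_sum// => k _.
have := ltn_ord k; rewrite ltnS => ki /=.
by rewrite -[in leRHS](subnK ki) exprD ler_wpM2l ?exprn_ge0// lerXn2r.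
Qed.

(** The square of the positive part has a first-order Taylor remainder of at most [h^2], kink
    included. For this reason the cutoff is always differentiated through its square. *)
Lemma is_derive_sqr_max0 (x : R) :
  is_derive x 1 (fun z : R => Num.max 0 z ^+ 2) (2 * Num.max 0 x).
Proof.
have key (h : R) : `|Num.max 0 (x + h) ^+ 2 - Num.max 0 x ^+ 2
    - 2 * Num.max 0 x * h| <= h ^+ 2.
  rewrite ler_norml !maxEle.
  by case: ifPn; rewrite -?ltNge => h1; case: ifPn; rewrite -?ltNge => h2;
    apply/andP; split; nra.
have lim : (fun h : R => h^-1 *: (Num.max 0 (h *: 1 + x) ^+ 2
    - Num.max 0 x ^+ 2)) @ 0^' --> 2 * Num.max 0 x.
  apply/cvgrPdist_le => e e0; near=> h.
  have h0 : h != 0 by near: h; exact: nbhs_dnbhs_neq.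
  have -> : 2 * Num.max 0 x - h^-1 *: (Num.max 0 (h *: 1 + x) ^+ 2 -
     Num.max 0 x ^+ 2) = - h^-1 * (Num.max 0 (x + h) ^+ 2 - Num.max 0 x ^+ 2
    - 2 * Num.max 0 x * h).
    rewrite -(scale1r h^-1) /GRing.scale/= mulr1 [h + x]addrC; field.
    by rewrite h0.
  rewrite normrM normrN normfV ler_pdivrMl ?normr_gt0//.
  apply: le_trans (key h) _.
  rewrite -real_normK ?num_real// expr2 ler_wpM2l//.
  near: h; apply: dnbhs0_le => //.
apply: DeriveDef; first by apply/cvg_ex; exists (2 * Num.max 0 x).
exact/cvg_lim.
Unshelve. all: by end_near. Qed.

(* Logarithmic cutoff, as a function of the parabolic distance
   [r = 1 + t + d(x0, x) ^ 2]: it equals 1 at [r = 1], and vanishes for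
   [r >= expR L]. *)
Definition log_cutoff L r : R := Num.max 0 (1 - ln r / L).

Lemma log_cutoff_ge0 L r : 0 <= log_cutoff L r.
Proof. by rewrite /log_cutoff le_max lexx. Qed.

Lemma log_cutoff_le1 L r : 0 <= L -> 1 <= r -> log_cutoff L r <= 1.
Proof.
move=> L0 r1; rewrite /log_cutoff ge_max ler01 /= gerBl.
by rewrite divr_ge0// ln_ge0.
Qed.

Lemma log_cutoff1 L : log_cutoff L 1 = 1.
Proof. by rewrite /log_cutoff ln1 mul0r subr0; apply/max_idPr. Qed.

Lemma log_cutoff_eq0 L r : 0 < L -> expR L <= r -> log_cutoff L r = 0.
Proof.
move=> L0 Lr; apply/max_idPl; rewrite subr_le0 ler_pdivlMr// mul1r.
by rewrite -[leLHS]expRK ler_ln// posrE ?(lt_le_trans _ Lr)// expR_gt0.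
Qed.

Lemma log_cutoff_gt0 L r : 0 < L -> 0 < r -> 0 < log_cutoff L r -> r < expR L.
Proof.
move=> L0 r0; apply: contraTT; rewrite -!leNgt => Lr.
by rewrite log_cutoff_eq0.
Qed.

Lemma log_cutoff_anti L r r' : 0 < L -> 0 < r -> r <= r' ->
  log_cutoff L r' <= log_cutoff L r.
Proof.
move=> L0 r0 rr'; rewrite /log_cutoff ge_max !le_max lexx /=; apply/orP; right.
by rewrite lerD2l lerN2 ler_pM2r ?invr_gt0// ler_ln ?posrE// (lt_le_trans r0).
Qed.

Lemma log_cutoff_sub L r r' : 0 < L -> 0 < r -> r <= r' ->
  log_cutoff L r - log_cutoff L r' <= (r' - r) / (L * r).
Proof.
move=> L0 r0 rr'; have r'0 := lt_le_trans r0 rr'.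
have lnr : ln r' - ln r <= (r' - r) / r.
  have : ln (r' / r) <= r' / r - 1.
    by rewrite -[in leLHS](subrKC 1 (r' / r)) le_ln1Dx// ltrBrDl subrr divr_gt0.
  by rewrite ln_div ?posrE// mulrBl divff// gt_eqF.
have {}lnr : ln r' / L - ln r / L <= (r' - r) / (L * r).
  by rewrite -mulrBl invfM mulrCA [leRHS]mulrC ler_wpM2r// invr_ge0 ltW.
have : 0 <= (r' - r) / (L * r) by rewrite divr_ge0 ?subr_ge0// mulr_ge0 ?ltW.
rewrite /log_cutoff !maxEle; case: ifPn => h1; case: ifPn => h2; lra.
Qed.

(** One step in [d] changes [r] by at most [2 d + 1], whose square is at most [8 r]; the logarithm
    divides the change by [L r], so one power of [r] survives after squaring. *)
Lemma log_cutoff_step L t d d' : 0 < L -> 0 <= t -> 0 <= d -> d <= d' ->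
  d' <= d + 1 ->
  (log_cutoff L (1 + t + d ^+ 2) - log_cutoff L (1 + t + d' ^+ 2)) ^+ 2 <=
  8 / (L ^+ 2 * (1 + t + d ^+ 2)).
Proof.
move=> L0 t0 d0 dd' d'd; set r := 1 + t + d ^+ 2; set r' := 1 + t + d' ^+ 2.
have r0 : 0 < r by rewrite /r; nra.
have rr' : r <= r' by rewrite /r /r'; nra.
apply: (@le_trans _ _ (((r' - r) / (L * r)) ^+ 2)).
  by rewrite lerXn2r ?nnegrE ?subr_ge0 ?log_cutoff_anti ?log_cutoff_sub//
     divr_ge0 ?subr_ge0// mulr_ge0 ?ltW.
have -> : ((r' - r) / (L * r)) ^+ 2 = ((r' - r) ^+ 2 / r) / (L ^+ 2 * r).
  by field; rewrite !gt_eqF.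
rewrite ler_wpM2r ?invr_ge0 ?mulr_ge0 ?(ltW L0) ?(ltW r0)//.
rewrite ler_pdivrMr//.
have h0 : 0 <= r' - r by rewrite subr_ge0.
have : r' - r <= 2 * d + 1 by rewrite /r /r'; nra.
have : (2 * d + 1) ^+ 2 <= 8 * r by rewrite /r; nra.
move=> h1 h2; apply: le_trans h1; rewrite lerXn2r// nnegrE; lra.
Qed.

Lemma is_derive_log_cutoff_sqr L t d : 0 < 1 + t + d ->
  is_derive t 1 (fun s => log_cutoff L (1 + s + d) ^+ 2)
    (- (2 * log_cutoff L (1 + t + d) / (L * (1 + t + d)))).
Proof.
move=> r0.
have dr : is_derive t 1 (fun s : R => 1 + s + d) 1.
  have := is_derive_shift t 1 (1 + d); congr is_derive.
  by apply/funext => s; rewrite /shift/= addrCA addrA.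
have dl : is_derive t 1 (fun s : R => 1 - ln (1 + s + d) / L)
    (- ((1 + t + d)^-1 / L)).
  have := is_derive1_ln r0 => dln.
  have := @is_derive1_comp _ _ (fun s : R => 1 + s + d) t _ _ dln dr.
  rewrite mulr1 => dc.
  have dcL : is_derive t 1 (fun s : R => ln (1 + s + d) / L) ((1 + t + d)^-1 / L).
    have := @is_deriveZ _ _ _ _ L^-1 t 1 _ dc.
    rewrite /GRing.scale /= mulrC; congr is_derive.
    by apply/funext => s /=; rewrite mulrC.
  have dk : is_derive t (1 : R) (cst (1 : R)) 0 by exact: is_derive_cst.
  by have := is_deriveB dk dcL; rewrite sub0r.
have := @is_derive1_comp _ _ _ t _ _ (is_derive_sqr_max0 _) dl.
congr is_derive; rewrite /log_cutoff.
by rewrite [L * _]mulrC invfM; ring.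
Qed.

(* Replaces Young's inequality by comparing [v `^ al] with a threshold: above it
   the reaction term dominates, below it [v] is explicitly bounded. The shift
   [dl], which keeps [v] positive, is negligible above the threshold. *)
Lemma reaction_absorbs al C L r phi u dl (j : nat) :
  0 < al -> al^-1 <= j%:R -> 1 <= C -> 1 <= L -> 1 <= r -> r <= expR L ->
  0 < phi -> phi <= 1 -> 0 <= u -> 0 < dl ->
  2 * dl <= (C / (L * expR L)) `^ al^-1 ->
  C / (L * r) * phi ^+ j.*2 * ((u + dl) * (u + dl) `^ (- L^-1)) <=
  u `^ (1 + al) * (u + dl) `^ (- L^-1) * phi ^+ j.+1.*2 +
  C * (C * 2 `^ (1 + al)) `^ al^-1 * expR (2 / al) *
    (L * r) `^ (- (1 + al^-1)).
Proof.
move=> al0 alj C1 L1 r1 rL phi0 phi1 u0 dl0 dlC.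
have L0 : 0 < L by exact: lt_le_trans L1.
have r0 : 0 < r by exact: lt_le_trans r1.
have C0 : 0 < C by exact: lt_le_trans C1.
have Lr0 : 0 < L * r by exact: mulr_gt0.
have v0 : 0 < u + dl by exact: ltr_wpDl.
have q0 : 0 < al^-1 by rewrite invr_gt0.
set v := u + dl in v0 *; set q := al^-1 in q0 alj dlC *.
set k := 2 `^ (1 + al); have k0 : 0 < k by exact: powR_gt0.
have k1 : 1 <= k.
  by rewrite -[leLHS](powRr0 2) ler_powR ?ler1n//; lra.
have w0 : 0 < v `^ (- L^-1) by exact: powR_gt0.
set A := C / (L * r); have A0 : 0 < A by exact: divr_gt0.
have f0 : 0 < phi ^+ j.*2 by exact: exprn_gt0.
have fS : phi ^+ j.+1.*2 = phi ^+ j.*2 * phi ^+ 2 by rewrite doubleS -addn2 exprD.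
have f2 : 0 < phi ^+ 2 by exact: exprn_gt0.
have f21 : phi ^+ 2 <= 1 by rewrite expr_le1// ltW.
(* Threshold for [v^al]: above it, [v^al phi^2 >= k A], where [k] pays for replacing [u] by
   [v <= 2 u] in the reaction term. *)
set M := A * k / phi ^+ 2; have M0 : 0 < M by rewrite !(mulr_gt0, invr_gt0).
have rest0 : 0 <= C * (C * k) `^ q * expR (2 * q) * (L * r) `^ (- (1 + q)).
  by rewrite !mulr_ge0 ?powR_ge0 ?expR_ge0// ltW.
have u10 : 0 <= u `^ (1 + al) by exact: powR_ge0.
have [Mv|vM] := leP M (v `^ al).
  (* Since [r <= expR L], being above the threshold forces [2 dl <= v], hence [v <= 2 u]. *)
  have MA : C / (L * expR L) <= M.
    rewrite /M -mulrA; apply: (@le_trans _ _ A).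
      by rewrite ler_pM2l// lef_pV2 ?posrE ?mulr_gt0 ?expR_gt0// ler_pM2l.
    rewrite ler_peMr ?(ltW A0)// ler_pdivlMr// mul1r.
    exact: le_trans k1.
  have vq : v = (v `^ al) `^ q.
    by rewrite -powRrM /q mulfV ?gt_eqF// powRr1// ltW.
  have dlv : 2 * dl <= v.
    apply: le_trans dlC _; rewrite [leRHS]vq ge0_ler_powR ?nnegrE ?powR_ge0//.
    + exact: ltW.
    + by rewrite divr_ge0 ?mulr_ge0 ?expR_ge0// ltW.
    + exact: le_trans Mv.
  have uv : v <= 2 * u by move: dlv; rewrite /v; lra.
  have vu : v `^ (1 + al) <= k * u `^ (1 + al).
    rewrite /k -powRM// ge0_ler_powR ?nnegrE ?mulr_ge0 ?(ltW v0)//.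
    by rewrite addr_ge0// ltW.
  have vS : v `^ (1 + al) = v * v `^ al.
    rewrite powRD; last by rewrite (gt_eqF v0) implybT.
    by rewrite powRr1// ltW.
  rewrite -[leLHS]addr0 lerD// fS.
  have {vu} vA : v * A <= u `^ (1 + al) * phi ^+ 2.
    rewrite -(ler_pM2l k0) [leRHS]mulrA.
    apply: (@le_trans _ _ (v `^ (1 + al) * phi ^+ 2)); last by rewrite ler_pM2r.
    by rewrite vS mulrCA -mulrA ler_pM2l// [k * A]mulrC -ler_pdivrMr.
  rewrite -subr_ge0; set U := _ `^ (1 + al) in vA *.
  have -> : U * v `^ (- L^-1) * (phi ^+ j.*2 * phi ^+ 2) -
      A * phi ^+ j.*2 * (v * v `^ (- L^-1)) =
      v `^ (- L^-1) * phi ^+ j.*2 * (U * phi ^+ 2 - v * A) by ring.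
  by rewrite mulr_ge0 ?subr_ge0// mulr_ge0 ?ltW.
have L1' : L^-1 <= 1 by rewrite invf_le1.
have iL0 : 0 < L^-1 by rewrite invr_gt0.
(* The exponent for which [v^(1 - 1/L) = (v^al)^s]; below the threshold this is at most [M^s]. *)
set s := q * (1 - L^-1).
have s0 : 0 <= s by rewrite mulr_ge0 ?subr_ge0// ltW.
have sq : s <= q by rewrite ler_piMr ?(ltW q0)//; lra.
have vw : v * v `^ (- L^-1) <= M `^ s.
  have -> : v * v `^ (- L^-1) = (v `^ al) `^ s.
    rewrite -powRrM /s mulrA /q mulfV ?gt_eqF// mul1r powRD; last first.
      by rewrite (gt_eqF v0) implybT.
    by rewrite powRr1// ltW.
  by rewrite ge0_ler_powR ?nnegrE ?powR_ge0 ?(ltW vM) ?(ltW M0).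
have Ms : M `^ s <= (C * k) `^ q * ((L * r) `^ (- q) * expR (2 * q)) *
   (phi ^+ j.*2)^-1.
  have -> : M = (C * k) * (L * r)^-1 * (phi ^+ 2)^-1 by rewrite /M /A; ring.
  have Ck0 : 0 < C * k by exact: mulr_gt0.
  have iLr0 : 0 < (L * r)^-1 by rewrite invr_gt0.
  have if0 : 0 < (phi ^+ 2)^-1 by rewrite invr_gt0.
  rewrite (powRM _ (ltW (mulr_gt0 Ck0 iLr0)) (ltW if0)).
  rewrite (powRM _ (ltW Ck0) (ltW iLr0)).
  apply: ler_pM; rewrite ?mulr_ge0 ?powR_ge0//.
    apply: ler_pM; rewrite ?powR_ge0//.
    by rewrite ler_powR// mulr_ege1.
    rewrite -powR_inv1 ?(ltW Lr0)// -powRrM mulN1r.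
    (* The surplus factor [(L r)^(q / L)] stays below [expR (2 q)] because [ln L] and [ln r] are
       both at most [L]. *)
    have -> : - s = - q + q / L by rewrite /s; ring.
    rewrite powRD; last by rewrite (gt_eqF Lr0) implybT.
    rewrite ler_pM2l ?powR_gt0// /powR gt_eqF// ler_expR lnM ?posrE//.
    rewrite [2 * q]mulrC -mulrA ler_pM2l// mulrC ler_pdivrMr//.
    have := ln_sublinear L0.
    have : ln r <= L by rewrite -[leRHS]expRK ler_ln ?posrE ?expR_gt0.
    lra.
  (* As [s <= q <= j], the singular power of [phi] is no worse than [phi^(- 2 j)], which the factor
     [phi^(2 j)] cancels. *)
  apply: (@le_trans _ _ ((phi ^+ 2)^-1 `^ j%:R)).
    by apply: ler_powR; [rewrite invf_ge1|exact: le_trans alj].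
  by rewrite powR_mulrn ?(ltW if0)// exprVn -exprM mul2n.
apply: (@le_trans _ _ (A * phi ^+ j.*2 * M `^ s)).
  by rewrite ler_wpM2l// mulr_ge0 ?ltW.
apply: (@le_trans _ _ (A * phi ^+ j.*2 * ((C * k) `^ q *
    ((L * r) `^ (- q) * expR (2 * q)) * (phi ^+ j.*2)^-1))).
  by rewrite ler_wpM2l// mulr_ge0 ?ltW.
rewrite opprD [(L * r) `^ (- 1 - q)]powRD; last by rewrite (gt_eqF Lr0) implybT.
rewrite powR_inv1 ?(ltW Lr0)// -[leLHS]add0r lerD//.
  by rewrite mulr_ge0 ?exprn_ge0 ?(ltW phi0)// mulr_ge0 ?(ltW w0).
rewrite le_eqVlt; apply/orP; left; apply/eqP; rewrite /A.
by field; rewrite !gt_eqF.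
Qed.
End Auxiliary.

(** * Graph distance, finite balls, summation by parts and dyadic volume sums *)

Section GraphLemmas.
Context {R : realType} {V : choiceType} (G : weighted_graph R V).
Implicit Types (x y z : V) (v h eta : V -> R).

Lemma gdist_path x y : exists p : seq V,
  [/\ path (adj G) x p, last x p = y & size p = gdist G x y].
Proof. by rewrite /gdist; case: ex_minnP => k /asboolP. Qed.

Lemma gdist_le x (p : seq V) : path (adj G) x p ->
  (gdist G x (last x p) <= size p)%N.
Proof.
move=> xp; rewrite /gdist; case: ex_minnP => k _; apply.
by apply/asboolP; exists p.
Qed.

Lemma gdistxx x : gdist G x x = 0%N.
Proof. by have := @gdist_le x [::] isT; rewrite leqn0 => /eqP. Qed.

Lemma gdist_adj x y z : adj G y z -> (gdist G x z <= (gdist G x y).+1)%N.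
Proof.
move=> yz; have [p [xp py <-]] := gdist_path x y.
have := @gdist_le x (rcons p z); rewrite last_rcons size_rcons rcons_path xp py.
exact.
Qed.

Lemma gdist_pred x y k : gdist G x y = k.+1 ->
  exists2 z, adj G z y & gdist G x z = k.
Proof.
move=> xy; have [p [xp py]] := gdist_path x y; rewrite xy.
case/lastP: p xp py => // p z; rewrite last_rcons rcons_path size_rcons.
move=> /andP[xp zy] zE [sp]; rewrite {z}zE in zy.
exists (last x p) => //; apply/eqP; rewrite eqn_leq -[X in (_ <= X)%N]sp gdist_le//=.
by rewrite -ltnS -xy gdist_adj.
Qed.

(** Induction on the integer radius: a vertex at distance [k + 1] is a neighbour of one at distance
    [k], and the graph is locally finite. *)
Lemma finite_gball x (r : R) : finite_set (gball G x r).
Proof.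
suff fin k : finite_set [set y | (gdist G x y <= k)%N].
  apply: (sub_finite_set _ (fin (Num.truncn r))) => y /= xy.
  by rewrite truncn_ge_nat// (le_trans _ xy).
elim: k => [|k IH].
  apply: (sub_finite_set _ (finite_set1 x)) => y /=; rewrite leqn0 => /eqP xy.
  by have [p [_ + sp]] := gdist_path x y; rewrite (size0nil (etrans sp xy)).
have fU : finite_set (\bigcup_(z in [set z | (gdist G x z <= k)%N])
    neighbours G z).
  by apply: bigcup_finite => // z _; exact: adj_locally_finite.
have := conj IH fU; rewrite -finite_setU; apply: sub_finite_set => y /=.
rewrite leq_eqVlt ltnS => /predU1P[/gdist_pred[z zy xz]|]; last by left.
by right; exists z => //=; rewrite xz.
Qed.

Lemma gball_fsumE x (r : R) (f : V -> R) :
  \sum_(y \in gball G x r) f y = \sum_(y <- fset_set (gball G x r)) f y.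
Proof. by rewrite fsbig_finite//; exact: finite_gball. Qed.

Lemma le_gball_fsum x (r r' : R) (f : V -> R) : r <= r' ->
  (forall y, 0 <= f y) ->
  \sum_(y \in gball G x r) f y <= \sum_(y \in gball G x r') f y.
Proof.
move=> rr' f0; rewrite [leRHS](fsbigID (gball G x r))/=; last first.
  exact: finite_gball.
rewrite (_ : _ `&` _ = gball G x r); last first.
  by apply/setIidr => y; rewrite /gball/= => /le_trans; apply.
by rewrite lerDl fsumr_ge0.
Qed.

Lemma weight_eq0 x y : ~~ adj G x y -> weight G x y = 0.
Proof.
by rewrite -weight_gt0 -leNgt => w0; apply/eqP; rewrite eq_le w0 weight_ge0.
Qed.

Lemma mu_laplacian x v : mu G x * laplacian G v x =
  \sum_(y \in neighbours G x) weight G x y * (v y - v x).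
Proof. by rewrite /laplacian mulVKf// gt_eqF// mu_gt0. Qed.

Lemma fsum_neighbours x (S : {fset V}) (f : V -> R) :
  (forall y, adj G x y -> y \in S) ->
  \sum_(y \in neighbours G x) weight G x y * f y =
  \sum_(y <- S) weight G x y * f y.
Proof.
move=> xS; rewrite [RHS](fsbig_seq _ _ (fset_uniq S)); apply: fsbig_widen => y //=.
  exact: xS.
by move=> [_ /negP xy]; rewrite weight_eq0// mul0r.
Qed.

Lemma sum_weight_le x (S : {fset V}) : \sum_(y <- S) weight G x y <= mdeg G x.
Proof.
have fN : finite_set (neighbours G x) by exact: adj_locally_finite.
have -> : mdeg G x = \sum_(y <- (S `|` fset_set (neighbours G x))%fset) weight G x y.
  rewrite /mdeg [RHS](fsbig_seq _ _ (fset_uniq _)); apply: fsbig_widen => y /=.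
    by move=> xy; rewrite inE in_fset_set// orbC; apply/orP; left; rewrite inE.
  by move=> [_ /negP xy]; rewrite weight_eq0.
rewrite [leRHS](big_fsetID _ (mem S))/= (_ : [fset _ | _ in _ & _]%fset = S).
  by rewrite lerDl sumr_ge0// => y _; exact: weight_ge0.
by apply/fsetP => y; rewrite !inE; case: (y \in S); rewrite ?andbF.
Qed.

(** Summation by parts against the test function [v^(- e) eta^2], followed by [edge_energy_le] on
    each edge. There is no boundary term since [S] contains the support of [eta] and its neighbours.
    The gradient bound [h] is charged to the endpoint where [eta] is larger. *)
Lemma discrete_energy_le (e : R) (S : {fset V}) v eta h :
  0 < e -> (forall x, 0 < v x) -> (forall x, 0 <= eta x) ->
  (forall x, 0 <= h x) ->
  (forall x, eta x != 0 -> x \in S /\ forall y, adj G x y -> y \in S) ->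
  (forall x y, adj G x y -> eta x <= eta y -> (eta y - eta x) ^+ 2 <= h y) ->
  - \sum_(x <- S) (1 + e^-1) * mdeg G x * (v x * v x `^ (- e) * h x) <=
  \sum_(x <- S) mu G x * laplacian G v x * (v x `^ (- e) * eta x ^+ 2).
Proof.
move=> e0 v0 eta0 h0 Seta etah; have c0 : 0 <= 1 + e^-1.
  by rewrite addr_ge0// invr_ge0 ltW.
set c := 1 + e^-1 in c0 *.
pose P x := v x `^ (- e) * eta x ^+ 2; pose g x := v x * v x `^ (- e) * h x.
have g0 x : 0 <= g x by rewrite !mulr_ge0 ?powR_ge0// ltW.
set X := leRHS.
have XE : X = \sum_(x <- S) \sum_(y <- S) weight G x y * ((v y - v x) * P x).
  apply: eq_bigr => x _; rewrite -/(P x) mu_laplacian.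
  have [z|/Seta[xS Sx]] := eqVneq (eta x) 0.
    rewrite /P z expr0n/= !mulr0 big1// => y _.
    by rewrite !mulr0.
  rewrite (fsum_neighbours _ Sx) mulr_suml; apply: eq_bigr => y _.
  by rewrite mulrA.
(* Exchanging the endpoints gives a second expression for [X]; adding the two makes the summand
   symmetric in the edge. *)
have XE' : X = \sum_(x <- S) \sum_(y <- S) weight G x y * ((v x - v y) * P y).
  rewrite XE exchange_big /=; apply: eq_bigr => x _; apply: eq_bigr => y _.
  by rewrite weight_sym.
have edge x y : - (c * (weight G x y * g x + weight G x y * g y)) <=
    weight G x y * ((v y - v x) * P x) + weight G x y * ((v x - v y) * P y).
  have [xy|/weight_eq0 ->] := boolP (adj G x y); last first.
    by rewrite !mul0r !addr0 mulr0 oppr0.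
  rewrite -!mulrDr mulrCA -mulrN ler_wpM2l ?weight_ge0//.
  have -> : (v y - v x) * P x + (v x - v y) * P y =
    (v y - v x) * (v x `^ (- e) * eta x ^+ 2 - v y `^ (- e) * eta y ^+ 2).
    by rewrite /P; ring.
  have [le|/ltW le] := leP (eta x) (eta y).
    apply: le_trans _ (edge_energy_le (v0 x) (v0 y) (eta0 x) le e0).
    rewrite lerN2 ler_wpM2l//; apply: (@le_trans _ _ (g y)); last by rewrite lerDr.
    by rewrite ler_wpM2l ?etah// mulr_ge0 ?powR_ge0// ltW.
  rewrite -[leRHS]mulrNN !opprB.
  apply: le_trans _ (edge_energy_le (v0 y) (v0 x) (eta0 y) le e0).
  rewrite lerN2 ler_wpM2l//; apply: (@le_trans _ _ (g x)); last by rewrite lerDl.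
  rewrite ler_wpM2l// ?etah//; last by rewrite -(adj_sym G).
  by rewrite mulr_ge0 ?powR_ge0// ltW.
have Wg : \sum_(x <- S) \sum_(y <- S) weight G x y * g x <=
    \sum_(x <- S) mdeg G x * g x.
  by apply: ler_sum => x _; rewrite -mulr_suml ler_wpM2r// sum_weight_le.
have Wg' : \sum_(x <- S) \sum_(y <- S) weight G x y * g y <=
    \sum_(x <- S) mdeg G x * g x.
  rewrite exchange_big /=; apply: le_trans Wg; rewrite le_eqVlt; apply/orP; left.
  by apply/eqP; apply: eq_bigr => x _; apply: eq_bigr => y _; rewrite weight_sym.
have : - (c * (\sum_(x <- S) \sum_(y <- S) weight G x y * g x +
    \sum_(x <- S) \sum_(y <- S) weight G x y * g y)) <= X + X.
  rewrite {1}XE XE' -!big_split/= mulr_sumr -sumrN; apply: ler_sum => x _.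
  by rewrite -!big_split/= mulr_sumr -sumrN; apply: ler_sum => y _.
have -> : \sum_(x <- S) c * mdeg G x * (v x * v x `^ (- e) * h x) =
    c * \sum_(x <- S) mdeg G x * g x.
  by rewrite mulr_sumr; apply: eq_bigr => x _; rewrite -mulrA.
nra.
Qed.

(* The critical weight [(1 + d ^ 2) `^ (- (m / 2))] contributes a bounded amount
   per dyadic annulus. *)
Lemma dyadic_volume_sum (C m : R) x0 : 0 <= m -> 0 <= C ->
  (forall k : nat, volume G x0 (2 ^+ k) <= C * 2 `^ (m * k%:R)) ->
  forall k : nat, \sum_(x \in gball G x0 (2 ^+ k))
    mu G x * (1 + (gdist G x0 x)%:R ^+ 2) `^ (- (m / 2)) <=
    C * 2 `^ m * k.+1%:R.
Proof.
move=> m0 C0 hV; have r1 x : 1 <= 1 + (gdist G x0 x)%:R ^+ 2 :> R.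
  by rewrite lerDl sqr_ge0.
have mu0 x : 0 <= mu G x by exact: ltW (mu_gt0 G x).
have m20 : 0 <= m / 2 by rewrite divr_ge0.
have k1 : 1 <= 2 `^ m :> R by rewrite -[leLHS](powRr0 2) ler_powR// ler1n.
elim=> [|k IH].
  rewrite mulr1; apply: (@le_trans _ _ (volume G x0 (2 ^+ 0))); last first.
    by apply: le_trans (hV 0%N) _; rewrite mulr0 powRr0 mulr1 ler_peMr.
  rewrite /volume !gball_fsumE; apply: ler_sum => x _.
  rewrite ler_piMr// powRN invf_le1 ?powR_gt0 ?(lt_le_trans ltr01)//.
  by rewrite -[leLHS](powRr0 (1 + (gdist G x0 x)%:R ^+ 2)) ler_powR.
rewrite (fsbigID (gball G x0 (2 ^+ k)))/=; last exact: finite_gball.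
rewrite (_ : _ `&` gball G x0 (2 ^+ k) = gball G x0 (2 ^+ k)); last first.
  apply/setIidr => y; rewrite /gball/= => /le_trans; apply.
  by rewrite ler_eXn2l// ltr1n.
rewrite -[k.+2%:R]natr1 mulrDr mulr1 lerD//.
set A := _ `&` _.
have fA : finite_set A by apply: finite_setIl; exact: finite_gball.
have := hV k.+1; rewrite /volume (fsbigID (gball G x0 (2 ^+ k)))/=; last first.
  exact: finite_gball.
rewrite -/A => hA.
have {}hA : \sum_(i \in A) mu G i <= C * 2 `^ (m * k.+1%:R).
  by apply: le_trans hA; rewrite lerDr fsumr_ge0.
(* On the annulus [d > 2^k] the weight is at most [2^(- m k)], against a volume of at most
   [C 2^(m (k + 1))]: the annulus contributes at most [C 2^m]. *)
apply: (@le_trans _ _ ((2 `^ (m * k%:R))^-1 * \sum_(i \in A) mu G i)).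
  rewrite !fsbig_finite// mulr_sumr big_seq [leRHS]big_seq; apply: ler_sum => x.
  rewrite in_fset_set// inE => -[_ /negP].
  rewrite /gball/= -ltNge => dx; rewrite mulrC ler_wpM2r// powRN.
  rewrite lef_pV2 ?posrE ?powR_gt0 ?(lt_le_trans ltr01 (r1 x))//.
  have -> : m * k%:R = k%:R * 2 * (m / 2) by field.
  rewrite powRrM ge0_ler_powR ?nnegrE ?powR_ge0 ?(le_trans ler01 (r1 x))//.
  rewrite powRrM powR_mulrn// powR_mulrn ?exprn_ge0//.
  apply: (@le_trans _ _ ((gdist G x0 x)%:R ^+ 2)); last by rewrite lerDr.
  by rewrite lerXn2r ?nnegrE ?exprn_ge0// ltW.
rewrite mulrC ler_pdivrMr ?powR_gt0// (le_trans hA)//.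
rewrite -[k.+1%:R]natr1 mulrDr mulr1 powRD; last by rewrite pnatr_eq0 implybT.
by rewrite [2 `^ (m * _) * _]mulrC mulrA.
Qed.
End GraphLemmas.

(** * Time derivatives of the terms of the test functional *)

Section Calculus.
Context {R : realType}.
Implicit Types (w : R -> R) (e L d t q : R).

Lemma is_derive_sum_seq (I : Type) (s : seq I) (f : I -> R -> R) (df : I -> R) t :
  (forall i, is_derive t 1 (f i) (df i)) ->
  is_derive t 1 (fun z => \sum_(i <- s) f i z) (\sum_(i <- s) df i).
Proof.
move=> fdf; elim: s => [|i s IH].
  have -> : (fun z => \sum_(i <- [::]) f i z) = cst 0.
    by apply/funext => z; rewrite big_nil.
  by rewrite big_nil; exact: is_derive_cst.
have -> : (fun z => \sum_(k <- i :: s) f k z) =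
    f i + (fun z => \sum_(k <- s) f k z).
  by apply/funext => z; rewrite big_cons.
by rewrite big_cons; exact: is_deriveD.
Qed.

Lemma is_derive_weighted_power w dw e L d (j : nat) t :
  0 < L -> is_derive t 1 w dw -> 0 < w t -> 0 < 1 + t + d ->
  is_derive t 1
    (fun s => w s `^ (1 - e) * (log_cutoff L (1 + s + d) ^+ 2) ^+ j.+1)
    ((1 - e) * (dw * (w t `^ (- e) * log_cutoff L (1 + t + d) ^+ j.+1.*2)) -
     w t * w t `^ (- e) * log_cutoff L (1 + t + d) ^+ j.*2 *
       (2 * j.+1%:R * log_cutoff L (1 + t + d) / (L * (1 + t + d)))).
Proof.
move=> L0 wdw w0 r0.
have d1 := @is_derive1_comp _ _ w t _ _ (is_derive1_powR (1 - e) w0) wdw.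
have d2 := is_deriveX j.+1 (is_derive_log_cutoff_sqr L r0).
have := is_deriveM d1 d2.
congr is_derive; first by apply/funext => s; rewrite !fctE.
rewrite /GRing.scale/= -!mul2n !exprM !fctE.
have -> : 1 - e - 1 = - e by ring.
have -> : w t `^ (1 - e) = w t * w t `^ (- e).
  rewrite powRD; last by rewrite (gt_eqF w0) implybT.
  by rewrite powRr1// ltW.
set c := log_cutoff _ _; rewrite [c ^+ 2 ^+ j.+1]exprS; field.
by rewrite !gt_eqF.
Qed.

(** A primitive in time of the error term, up to sign; it lets the error be built into the
    functional instead of integrated. *)
Lemma is_derive_shift_powR q d t : 0 < q -> 0 < 1 + t + d ->
  is_derive t 1 (fun s => q^-1 * (1 + s + d) `^ (- q))
    (- ((1 + t + d) `^ (- (1 + q)))).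
Proof.
move=> q0 r0.
have dr : is_derive t 1 (fun s : R => 1 + s + d) 1.
  have := is_derive_shift t 1 (1 + d); congr is_derive.
  by apply/funext => s; rewrite /shift/= addrCA addrA.
have := @is_derive1_comp _ _ _ t _ _ (is_derive1_powR (- q) r0) dr.
move=> /(@is_deriveZ _ _ _ _ q^-1 t 1).
congr is_derive; rewrite /GRing.scale/= mulr1 mulrA mulrN mulVf ?gt_eqF//.
by rewrite mulN1r opprD [- 1 - q]addrC.
Qed.

End Calculus.

(** * Evolution of the test functional *)

Section TestFunction.
Context {R : realType} {V : choiceType} (G : weighted_graph R V).
Implicit Types (x y : V).

Lemma laplacian_shift (f : V -> R) (k : R) x :
  laplacian G (fun y => f y + k) x = laplacian G f x.
Proof.
rewrite /laplacian; congr (_ * _); apply: eq_fsbigr => y _; congr (_ * _).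
by rewrite opprD addrACA subrr addr0.
Qed.

(** Balance at a single vertex: [W] carries the diffusion and cutoff costs, [U] is the reaction term
    and [k] the error. Since [L >= 2], [(1 + L) / L <= 2] turns the diffusion constant 8 into 16,
    and [1 - 1/L >= 1/2] turns the cutoff constant 2 into 4. *)
Lemma dissipation_le (D L e r k q c W U M md : R) (j : nat) :
  0 <= D -> 2 <= L -> e = L^-1 -> 1 <= r -> 0 <= c -> c <= 1 -> 0 <= W ->
  0 <= k -> 0 < M -> 0 <= md -> md <= D * M ->
  (16 * D * j.+1%:R ^+ 2 + 4 * j.+1%:R) / (L * r) * W <= U + k ->
  0 <= - ((1 - e) * ((1 + e^-1) * md * (W * (j.+1%:R ^+ 2 * (8 / (L ^+ 2 * r))))))
    + M * ((1 - e) * U - W * (2 * j.+1%:R * c / (L * r)) + k).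
Proof.
move=> D0 L2 -> r1 c0 c1 W0 k0 M0 md0 mdD; rewrite invrK.
have L0 : 0 < L by lra.
have r0 : 0 < r by lra.
have Lr0 : 0 < L * r by exact: mulr_gt0.
set i := j.+1%:R; have i0 : 0 <= i :> R by exact: ler0n.
have iL : L^-1 <= 2^-1 by rewrite lef_pV2 ?posrE.
have iL0 : 0 < L^-1 by rewrite invr_gt0.
set b := 1 - L^-1; have b0 : 2^-1 <= b by rewrite /b; lra.
have b1 : b <= 1 by rewrite /b; lra.
set X := W / (L * r); have X0 : 0 <= X by rewrite divr_ge0// ltW.
have -> : (16 * D * i ^+ 2 + 4 * i) / (L * r) * W =
  (16 * D * i ^+ 2 + 4 * i) * X by rewrite /X; ring.
move=> abs.
have t1 : (1 + L) * md * (W * (i ^+ 2 * (8 / (L ^+ 2 * r)))) <=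
    M * (16 * D * i ^+ 2 * X).
  have -> : (1 + L) * md * (W * (i ^+ 2 * (8 / (L ^+ 2 * r)))) =
    md * (((1 + L) / L) * (8 * i ^+ 2 * X)).
    by rewrite /X; field; rewrite !gt_eqF.
  have Y0 : 0 <= 8 * i ^+ 2 * X by rewrite mulr_ge0// mulr_ge0// exprn_ge0.
  have LL : (1 + L) / L <= 2 by rewrite ler_pdivrMr//; lra.
  have LL0 : 0 <= (1 + L) / L by rewrite divr_ge0//; lra.
  have -> : M * (16 * D * i ^+ 2 * X) = (D * M) * (2 * (8 * i ^+ 2 * X)) by ring.
  by apply: ler_pM => //; [exact: mulr_ge0|exact: ler_wpM2r].
have t2 : W * (2 * i * c / (L * r)) <= b * (4 * i * X).
  have -> : W * (2 * i * c / (L * r)) = (2 * i * X) * c by rewrite /X; ring.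
  have -> : b * (4 * i * X) = (2 * i * X) * (2 * b) by ring.
  by apply: ler_wpM2l; [rewrite mulr_ge0// mulr_ge0|lra].
have t3 : b * ((16 * D * i ^+ 2 + 4 * i) * X) <= b * U + k.
  apply: (@le_trans _ _ (b * (U + k))); first by rewrite ler_wpM2l//; lra.
  by rewrite mulrDr lerD2l ler_piMl.
have := ler_wpM2l (_ : 0 <= b) t1; move=> /(_ ltac:(lra)) t1'.
rewrite addrC subr_ge0; apply: (le_trans t1').
rewrite mulrCA ler_pM2l//; lra.
Qed.

(** The functional [F], corrected by a primitive of the error, has nonnegative derivative on the
    open interval. At time [expR L] the cutoff vanishes everywhere, so [F (expR L) <= 0], and the
    mean value theorem gives [F 0 <= 0]. Keeping only [x0] in the positive part of [F 0] gives the
    bound. *)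
Lemma initial_mass_le (D C al L : R) (j : nat) (a : V -> R) (u : R -> V -> R)
    (S : {fset V}) x0 :
  0 <= D -> (forall x, mdeg G x <= D * mu G x) ->
  0 < al -> al^-1 <= j%:R -> 2 <= L ->
  (forall x, (gdist G x0 x)%:R ^+ 2 < expR L ->
    x \in S /\ forall y, adj G x y -> y \in S) ->
  0 < a x0 -> nonneg_solution G al a (expR L) u ->
  C = 16 * D * j.+1%:R ^+ 2 + 4 * j.+1%:R ->
  mu G x0 * Num.min 1 (a x0) <=
  C * (C * 2 `^ (1 + al)) `^ al^-1 * expR (2 / al) * L `^ (- (1 + al^-1)) *
  (al * \sum_(x <- S) mu G x * (1 + (gdist G x0 x)%:R ^+ 2) `^ (- al^-1)).
Proof.
move=> D0 mdegD al0 alj L2 hS ax0 [u0 uc du ua] CE.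
have L0 : 0 < L by lra.
have q0 : 0 < al^-1 by rewrite invr_gt0.
set q := al^-1 in q0 alj *.
have mu0 x : 0 < mu G x by exact: mu_gt0.
have T0 : 0 < expR L by exact: expR_gt0.
have C1 : 1 <= C.
  have j1 : 1 <= j.+1%:R :> R by rewrite ler1n.
  have : 0 <= 16 * D * j.+1%:R ^+ 2 by rewrite mulr_ge0 ?exprn_ge0// mulr_ge0.
  by rewrite CE; lra.
have C0 : 0 < C by exact: lt_le_trans C1.
(* The largest shift that [reaction_absorbs] allows; it keeps [v] positive, so that its negative
   powers are differentiable. *)
pose dl := (C / (L * expR L)) `^ q / 2.
have dl0 : 0 < dl by rewrite divr_gt0// powR_gt0// divr_gt0// mulr_gt0.
have dlE : 2 * dl <= (C / (L * expR L)) `^ q by rewrite /dl mulrC divfK.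
set K := C * _ * _; have K0 : 0 < K.
  by rewrite !mulr_gt0 ?powR_gt0 ?expR_gt0// mulr_gt0// powR_gt0.
pose k := K * L `^ (- (1 + q)); have k0 : 0 < k by rewrite mulr_gt0// powR_gt0.
rewrite -/k.
pose d x : R := (gdist G x0 x)%:R.
pose r t x := 1 + t + d x ^+ 2.
have r1 t x : 0 <= t -> 1 <= r t x.
  by move=> t0; rewrite /r -addrA lerDl addr_ge0// sqr_ge0.
pose c t x := log_cutoff L (r t x).
pose v t x := u t x + dl.
pose f x t := mu G x * (v t x `^ (1 - L^-1) * (c t x ^+ 2) ^+ j.+1 -
  k * (q^-1 * r t x `^ (- q))).
pose lap t x := laplacian G (u t) x + u t x `^ (1 + al).
pose df t x := mu G x * (
  (1 - L^-1) * (lap t x * (v t x `^ (- L^-1) * c t x ^+ j.+1.*2)) -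
    v t x * v t x `^ (- L^-1) * c t x ^+ j.*2 *
       (2 * j.+1%:R * c t x / (L * r t x)) +
  k * r t x `^ (- (1 + q))).
have v0 t x : t \in `[0, expR L] -> 0 < v t x.
  by move=> tT; rewrite /v ltr_wpDl// u0.
have dfE t x : t \in `]0, expR L[ -> is_derive t 1 (f x) (df t x).
  move=> tT; have tT' : t \in `[0, expR L] by exact: subset_itv_oo_cc tT.
  have t0 : 0 <= t by move: tT'; rewrite in_itv/= => /andP[].
  have r0 : 0 < r t x by exact: lt_le_trans ltr01 (r1 t x t0).
  have dv : is_derive t 1 (fun s => v s x) (lap t x).
    have dk : is_derive t (1 : R) (cst dl) 0 by exact: is_derive_cst.
    by have := is_deriveD (du t x tT) dk; rewrite addr0.
  have d1 := is_derive_weighted_power L^-1 j L0 dv (v0 t x tT') r0.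
  have d2 := @is_deriveZ _ _ _ _ k t 1 _ (is_derive_shift_powR q0 r0).
  have := @is_deriveZ _ _ _ _ (mu G x) t 1 _ (is_deriveB d1 d2).
  by rewrite /GRing.scale/= mulrN opprK.
(* The equation is only available on the open interval, so continuity up to the endpoints is proved
   separately for the mean value theorem. *)
have fc x : {within `[0, expR L], continuous (f x)}.
  have smooth (g dg : R -> R) :
      (forall t, t \in `[0, expR L] -> is_derive t 1 g (dg t)) ->
      {within `[0, expR L], continuous g}.
    move=> gdg; apply: continuous_in_subspaceT => t; rewrite inE => /gdg dgt.
    by apply: differentiable_continuous; apply/derivable1_diffP; exact: ex_derive.
  have r0 t : t \in `[0, expR L] -> 0 < r t x.
    by rewrite in_itv/= => /andP[t0 _]; exact: lt_le_trans ltr01 (r1 t x t0).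
  have c1 : {within `[0, expR L], continuous (fun t => (c t x ^+ 2) ^+ j.+1)}.
    rewrite (_ : (fun t => _) = (fun t => c t x ^+ 2) ^+ j.+1); last first.
      by apply/funext => t; rewrite !fctE.
    exact: smooth (fun t tT =>
      is_deriveX j.+1 (is_derive_log_cutoff_sqr L (r0 t tT))).
  have c2 := smooth _ _ (fun t tT => is_derive_shift_powR q0 (r0 t tT)).
  have c3 : {within `[0, expR L], continuous (fun t => v t x `^ (1 - L^-1))}.
    rewrite continuous_subspace_in => t; rewrite inE => tT.
    have c4 : continuous_at (v t x) (fun z : R => z `^ (1 - L^-1)).
      apply: differentiable_continuous; apply/derivable1_diffP.
      by apply: derivable_powR; rewrite in_itv/= andbT v0.
    have c5 : {within `[0, expR L], continuous (fun t => v t x)}.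
      by move=> s; apply: cvgD; [exact: uc|exact: cvg_cst].
    exact: continuous_comp (c5 t) c4.
  move=> t; apply: cvgM; first exact: cvg_cst.
  apply: cvgB; last by apply: cvgM; [exact: cvg_cst|exact: c2].
  by apply: cvgM; [exact: c3|exact: c1].
pose F t := \sum_(x <- S) f x t.
have FT : F (expR L) <= 0.
  rewrite /F big_seq sumr_le0// => x _; rewrite /f /c log_cutoff_eq0//; last first.
    by rewrite /r addrAC lerDr addr_ge0// sqr_ge0.
  rewrite expr0n/= expr0n/= mulr0 add0r mulrN oppr_le0.
  by rewrite mulr_ge0 ?(ltW (mu0 x))// mulr_ge0 ?(ltW k0)//
     mulr_ge0 ?powR_ge0// ltW// invr_gt0.
have dF_ge0 t : t \in `]0, expR L[ -> 0 <= \sum_(x <- S) df t x.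
  move=> tT; have tT' : t \in `[0, expR L] by exact: subset_itv_oo_cc tT.
  have t0 : 0 <= t by move: tT'; rewrite in_itv/= => /andP[].
  have r0 x : 0 < r t x by exact: lt_le_trans ltr01 (r1 t x t0).
  have c0 x : 0 <= c t x by exact: log_cutoff_ge0.
  pose h x := j.+1%:R ^+ 2 * (c t x ^+ j.*2 * (8 / (L ^+ 2 * r t x))).
  have en := @discrete_energy_le R V G L^-1 S (v t) (fun x => c t x ^+ j.+1) h.
  have {}en : - (\sum_(x <- S) (1 + L^-1^-1) * mdeg G x *
       (v t x * v t x `^ (- L^-1) * h x)) <=
      \sum_(x <- S) mu G x * laplacian G (u t) x *
        (v t x `^ (- L^-1) * c t x ^+ j.+1.*2).
    apply: le_trans (en _ _ _ _ _ _) _.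
    - by rewrite invr_gt0.
    - by move=> x; exact: v0.
    - by move=> x; exact: exprn_ge0.
    - move=> x; rewrite /h mulr_ge0 ?exprn_ge0// mulr_ge0 ?exprn_ge0//.
      by rewrite divr_ge0// mulr_ge0 ?exprn_ge0// ltW.
    - move=> x; rewrite expf_eq0/= => cx; apply: hS.
      have : 0 < c t x by rewrite lt_neqAle eq_sym cx c0.
      move=> /(log_cutoff_gt0 L0 (r0 x)); apply: le_lt_trans.
      by rewrite /r lerDr addr_ge0.
    - move=> x y xy cxy.
      have {}cxy : c t x <= c t y.
        by move: cxy; rewrite ler_pXn2r ?nnegrE.
      apply: le_trans (exprS_sub_le j (c0 x) cxy) _.
      rewrite ler_wpM2l ?exprn_ge0// ler_wpM2l ?exprn_ge0//.
      have [yx|/ltW xy'] := leP (d y) (d x).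
        apply: log_cutoff_step => //.
        by rewrite /d natr1 ler_nat gdist_adj// -(adj_sym G).
      (* If [y] is farther from [x0] than [x], monotonicity of the cutoff forces equality and the
         gradient vanishes. *)
      have cyx : c t y <= c t x.
        by apply: log_cutoff_anti => //; rewrite /r lerD2l lerXn2r ?nnegrE.
      have -> : c t y = c t x by apply/eqP; rewrite eq_le cxy cyx.
      by rewrite subrr expr0n/= divr_ge0// mulr_ge0 ?exprn_ge0// ltW.
    rewrite le_eqVlt; apply/orP; left; apply/eqP; apply: eq_bigr => x _.
    by rewrite laplacian_shift -exprM muln2.
  have b0 : 0 <= 1 - L^-1 by rewrite subr_ge0 invf_le1//; lra.
  have {}en := ler_wpM2l b0 en.
  have -> : \sum_(x <- S) df t x =
     (1 - L^-1) * (\sum_(x <- S) mu G x * laplacian G (u t) x *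
        (v t x `^ (- L^-1) * c t x ^+ j.+1.*2)) +
     \sum_(x <- S) mu G x * ((1 - L^-1) * (u t x `^ (1 + al) *
        v t x `^ (- L^-1) * c t x ^+ j.+1.*2) -
       v t x * v t x `^ (- L^-1) * c t x ^+ j.*2 *
         (2 * j.+1%:R * c t x / (L * r t x)) + k * r t x `^ (- (1 + q))).
    rewrite mulr_sumr -big_split/=; apply: eq_bigr => x _.
    by rewrite /df /lap; ring.
  apply: le_trans (lerD en (lexx _)).
  rewrite mulrN mulr_sumr -sumrN -big_split/= big_seq sumr_ge0// => x _.
  have W0 : 0 <= v t x * v t x `^ (- L^-1) * c t x ^+ j.*2.
    by rewrite mulr_ge0 ?exprn_ge0// mulr_ge0 ?powR_ge0// ltW// v0.
  have kr0 : 0 <= k * r t x `^ (- (1 + q)) by rewrite mulr_ge0 ?powR_ge0// ltW.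
  have U0 : 0 <= u t x `^ (1 + al) * v t x `^ (- L^-1) * c t x ^+ j.+1.*2.
    by rewrite mulr_ge0 ?exprn_ge0// mulr_ge0 ?powR_ge0.
  rewrite /h; set W := _ * c t x ^+ j.*2 in W0 *.
  rewrite [X in - (_ * (_ * X))](_ : _ =
      W * (j.+1%:R ^+ 2 * (8 / (L ^+ 2 * r t x)))); last first.
    by rewrite /W; ring.
  apply: (@dissipation_le D) => //; rewrite -?CE.
  - exact: r1.
  - by rewrite log_cutoff_le1 ?r1// ltW.
  - by rewrite /mdeg fsumr_ge0// => y _; exact: weight_ge0.
  (* [reaction_absorbs] divides by the cutoff; where the cutoff vanishes, [W] vanishes too because
     [j > 0]. *)
  have [c00|cn0] := eqVneq (c t x) 0.
    have j0 : (0 < j)%N by rewrite -(ltr_nat R) (lt_le_trans q0).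
    have -> : W = 0 by rewrite /W c00 expr0n double_eq0 eqn0Ngt j0 mulr0.
    by rewrite mulr0 addr_ge0.
  have c_gt0 : 0 < c t x by rewrite lt_neqAle eq_sym cn0 c0.
  have kE : K * (L * r t x) `^ (- (1 + q)) = k * r t x `^ (- (1 + q)).
    by rewrite powRM ?(ltW L0) ?(ltW (r0 x))// mulrA.
  have := @reaction_absorbs R al C L (r t x) (c t x) (u t x) dl j al0 alj C1 _ _ _ c_gt0.
  rewrite -/q -/K kE => H.
  apply: le_trans (H _ _ _ _ _ _ _) => //.
  - by rewrite le_eqVlt; apply/orP; left; apply/eqP; rewrite /W /v; ring.
  - lra.
  - exact: r1.
  - exact: ltW (log_cutoff_gt0 L0 (r0 x) c_gt0).
  - by rewrite log_cutoff_le1 ?r1// ltW.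
  - exact: u0.
have F0T : F 0 <= 0.
  apply: le_trans FT.
  have Fd t : t \in `]0, expR L[ -> is_derive t 1 F (\sum_(x <- S) df t x).
    by move=> tT; apply: is_derive_sum_seq => x; exact: dfE.
  have Fc : {within `[0, expR L], continuous F}.
    apply: continuous_big => [|x _]; last exact: fc.
    exact: add_continuous.
  have [t tT E] := MVT T0 Fd Fc.
  by rewrite -subr_ge0 E mulr_ge0 ?dF_ge0// subr0 ltW.
have in0 : 0 \in `[0, expR L] by rewrite in_itv/= lexx ltW.
have c0 : c 0 x0 = 1.
  by rewrite /c /r /d gdistxx expr0n/= !addr0 log_cutoff1.
have x0S : x0 \in S by apply: (hS x0 _).1; rewrite gdistxx expr0n.
have : F 0 = \sum_(x <- S) mu G x * (v 0 x `^ (1 - L^-1) * (c 0 x ^+ 2) ^+ j.+1)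
  - k * (al * \sum_(x <- S) mu G x * (1 + (gdist G x0 x)%:R ^+ 2) `^ (- q)).
  rewrite !mulr_sumr -sumrB; apply: eq_bigr => x _.
  by rewrite /f /r addr0 /q invrK -/(d x); ring.
move=> FE; rewrite FE subr_le0 in F0T; apply: le_trans F0T.
rewrite (big_fsetD1 x0)//= -[leLHS]addr0 lerD//; last first.
  rewrite big_seq sumr_ge0// => x _.
  by rewrite mulr_ge0 ?(ltW (mu0 x))// mulr_ge0 ?powR_ge0// exprn_ge0// sqr_ge0.
rewrite ler_pM2l// c0 expr1n expr1n mulr1.
have L1 : L^-1 <= 1 by rewrite invf_le1//; lra.
have va : a x0 <= v 0 x0 by rewrite /v ua lerDl ltW.
(* The exponent [1 - 1/L] lies in [[0, 1]]: the power is at least 1 if [v >= 1], and at least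
   [v >= a x0] otherwise. The minimum makes the lower bound independent of [L]. *)
rewrite ge_min; have [v1|v1] := leP 1 (v 0 x0).
  by rewrite -[X in X <= _](powRr0 (v 0 x0)) ler_powR ?subr_ge0.
apply/orP; right; apply: (le_trans va); rewrite ger1_powR ?v0// ?(ltW v1)//.
by rewrite lerBlDr lerDl invr_ge0 ltW.
Qed.
End TestFunction.

(** * Choice of constants and scale, and the contradiction *)

Lemma D_mu_bound (R : realType) (V : choiceType) (G : weighted_graph R V) :
  (D_mu G < +oo)%E ->
  exists2 D : R, 0 <= D & forall x, mdeg G x <= D * mu G x.
Proof.
move=> Doo; have ub x : ((mdeg G x / mu G x)%:E <= D_mu G)%E.
  by apply: ereal_sup_ubound; exists x.
exists (Num.max 0 (fine (D_mu G))) => [|x]; first by rewrite le_max lexx.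
rewrite -ler_pdivrMr ?mu_gt0// le_max; apply/orP; right.
by have := ub x; case: (D_mu G) Doo.
Qed.

(** Radii below [r0] are compared with [r0] itself by monotonicity of the volume, at the price of
    the extra constant [r0^m]. *)
Lemma volume_dyadic_le (R : realType) (V : choiceType) (G : weighted_graph R V)
    (c r0 m : R) (x0 : V) (k : nat) : 0 < c -> 0 < r0 -> 0 <= m ->
  (forall r, r0 <= r -> volume G x0 r <= c * r `^ m) ->
  volume G x0 (2 ^+ k) <= c * (1 + r0 `^ m) * 2 `^ (m * k%:R).
Proof.
move=> c0 r00 m0 hV; have r0m : 0 <= r0 `^ m by exact: powR_ge0.
have k2 : 1 <= 2 `^ (m * k%:R) :> R.
  by rewrite -[leLHS](powRr0 2) ler_powR ?ler1n// mulr_ge0.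
have [rk|/ltW kr] := leP r0 (2 ^+ k).
  apply: le_trans (hV _ rk) _.
  rewrite [m * _]mulrC powRrM powR_mulrn// ler_wpM2r ?powR_ge0//.
  by rewrite ler_peMr ?(ltW c0)// lerDl.
apply: (@le_trans _ _ (volume G x0 r0)).
  by rewrite /volume le_gball_fsum// => y; exact: ltW (mu_gt0 G y).
apply: le_trans (hV _ (lexx _)) _.
rewrite -mulrA ler_pM2l//; apply: (@le_trans _ _ (1 + r0 `^ m)).
  by rewrite lerDr.
by rewrite ler_peMr// addr_ge0.
Qed.

Theorem theorem1p1 (R : realType) (V : choiceType) (G : weighted_graph R V)
    (n : R) (a : V -> R) (m alpha : R)
    (homega : (0 < omega_min G)%E)
    (hDmu : (D_mu G < +oo)%E)
    (hDomega : (D_omega G < +oo)%E)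
    (hn : 0 < n)
    (hCDE : CDE' G n 0)
    (ha_bounded : exists M : R, forall x, `|a x| <= M)
    (ha_ge0 : forall x, 0 <= a x)
    (ha_neq0 : exists x, a x != 0)
    (hm : 0 < m)
    (hvol : exists (c r0 : R) (x0 : V),
        [/\ 0 < c, 0 < r0, 0 < a x0 &
            forall r : R, r0 <= r ->
              c^-1 * r `^ m <= volume G x0 r /\ volume G x0 r <= c * r `^ m])
    (halpha : alpha = 2 / m) :
  forall (tau : \bar R) (u : R -> V -> R),
    nonneg_solution_upto G alpha a tau u -> blows_up tau u.
Proof.
move=> tau u [tau0 sol]; have [c [r0 [x0 [c0 r00 ax0 hV]]]] := hvol.
(* A finite lifetime bounds [T_infty] at once; what remains is to show that no solution lives on all
   of [[0, +oo)]. *)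
case: tau tau0 sol => [t| |//] _ sol.
  apply: (@le_lt_trans _ _ t%:E); last exact: ltry.
  by apply: ge_ereal_sup => _ [T [Tt _] <-].
exfalso.
have al0 : 0 < alpha by rewrite halpha divr_gt0.
have qE : alpha^-1 = m / 2 by rewrite halpha invf_div.
have q0 : 0 < alpha^-1 by rewrite invr_gt0.
have [D D0 hD] := D_mu_bound hDmu.
pose j := (Num.truncn alpha^-1).+1.
have alj : alpha^-1 <= j%:R by rewrite ltW// truncnS_gt.
pose C := 16 * D * j.+1%:R ^+ 2 + 4 * j.+1%:R.
have C0 : 0 < C.
  by rewrite ltr_wpDl ?mulr_gt0// !mulr_ge0.
pose K := C * (C * 2 `^ (1 + alpha)) `^ alpha^-1 * expR (2 / alpha).
have K0 : 0 < K.
  by rewrite !mulr_gt0 ?powR_gt0 ?expR_gt0// mulr_gt0// powR_gt0.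
pose Cv := c * (1 + r0 `^ m).
have Cv0 : 0 < Cv by rewrite mulr_gt0// ltr_pwDl// powR_ge0.
(* With [L = k ln 4] one has [expR L = (2^k)^2], so the cutoff is supported in the ball of radius
   [2^k], and the ball of radius [2^(k + 1)] also contains the neighbours. *)
pose l : R := ln 4; have l0 : 0 < l by rewrite ln_gt0// ltr1n.
pose M := mu G x0 * Num.min 1 (a x0).
have M0 : 0 < M by rewrite mulr_gt0 ?mu_gt0// lt_min ltr01.
pose B := K * (alpha * (Cv * 2 `^ m * 3)) / l.
have B0 : 0 < B.
  by rewrite divr_gt0// mulr_gt0// mulr_gt0// mulr_gt0// mulr_gt0// powR_gt0.
have decay k : (0 < k)%N -> 2 <= k%:R * l -> M * (k%:R * l) `^ alpha^-1 <= B.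
  move=> k0 L2; set L := k%:R * l in L2 *.
  have L0 : 0 < L by lra.
  have eL : expR L = (2 ^+ k) ^+ 2.
    rewrite /L /l expRM_natl lnK ?posrE// -exprM mulnC exprM; congr (_ ^+ _).
    by rewrite expr2 -natrM.
  pose S := fset_set (gball G x0 (2 ^+ k.+1)).
  have fS : finite_set (gball G x0 (2 ^+ k.+1)) by exact: finite_gball.
  have hS x : (gdist G x0 x)%:R ^+ 2 < expR L ->
      x \in S /\ forall y, adj G x y -> y \in S.
    rewrite eL ltr_pXn2r ?nnegrE ?exprn_ge0// => dx.
    have k1 : 1 <= 2 ^+ k :> R by rewrite exprn_ege1// ler1n.
    split=> [|y xy]; rewrite in_fset_set// inE /gball/= exprS; first lra.
    have : (gdist G x0 y)%:R <= (gdist G x0 x)%:R + 1 :> R.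
      by rewrite natr1 ler_nat gdist_adj.
    lra.
  have solL : nonneg_solution G alpha a (expR L) u.
    by apply: sol; rewrite ?expR_gt0// ltry.
  have := initial_mass_le D0 hD al0 alj L2 hS ax0 solL erefl.
  rewrite -/C -/K -/M -gball_fsumE qE => Mle.
  have vol := dyadic_volume_sum (ltW hm) (ltW Cv0)
    (fun k => volume_dyadic_le k c0 r00 (ltW hm) (fun r hr => (hV r hr).2)) k.+1.
  have {vol} : M <= K * L `^ (- (1 + m / 2)) * (alpha * (Cv * 2 `^ m * k.+2%:R)).
    apply: le_trans Mle _; rewrite ler_wpM2l ?ler_wpM2l ?(ltW al0)//.
    by rewrite mulr_ge0 ?powR_ge0// ltW.
  rewrite opprD powRD; last by rewrite (gt_eqF L0) implybT.
  rewrite powR_inv1 ?(ltW L0)// powRN => {}Mle.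
  rewrite -ler_pdivlMr ?powR_gt0//; apply: (le_trans Mle).
  have k1 : 1 <= k%:R :> R by rewrite ler1n.
  (* The number of annuli is at most [3 k = 3 L / l]; this cancels [L^-1], leaves [L^(- m/2)], and
     explains the factor [3 / l] in [B]. *)
  have k3 : k.+2%:R <= 3 * k%:R :> R by rewrite -addn2 natrD; lra.
  have -> : B / L `^ (m / 2) = K * (L^-1 / L `^ (m / 2)) *
      (alpha * (Cv * 2 `^ m * (3 * k%:R))).
    rewrite /B /L; field.
    by rewrite !gt_eqF ?powR_gt0// ltr0n.
  rewrite ler_wpM2l ?ler_wpM2l ?(ltW al0)//.
    by rewrite mulr_ge0 ?(ltW K0)// divr_ge0 ?powR_ge0// invr_ge0 ltW.
  by rewrite mulr_ge0 ?powR_ge0// ltW.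
(* Any [L > b] satisfies [L >= 2] and [L^(1 / alpha) >= B / M + 1], which contradicts [decay]. *)
pose b := Num.max 2 ((B / M + 1) `^ alpha).
pose k := (Num.truncn (b / l)).+1.
have bk : b < k%:R * l by rewrite -ltr_pdivrMr// truncnS_gt.
have b2 : 2 <= b by rewrite le_max lexx.
have := decay k isT (ltW (le_lt_trans b2 bk)).
rewrite -ler_pdivlMl// [M^-1 * B]mulrC leNgt => /negP; apply.
have BM0 : 0 < B / M by exact: divr_gt0.
apply: (@lt_le_trans _ _ (B / M + 1)); first by rewrite ltrDl.
have -> : B / M + 1 = ((B / M + 1) `^ alpha) `^ alpha^-1.
  by rewrite -powRrM mulfV ?gt_eqF// powRr1// addr_ge0// ltW.
rewrite ge0_ler_powR ?nnegrE ?powR_ge0 ?(ltW q0)//.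
  by rewrite (le_trans _ (ltW bk))// (le_trans _ b2).
by rewrite (le_trans _ (ltW bk))// le_max lexx orbT.
Qed.
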